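(* Let $G=(V,P,d)$ be a reversible metric Markov chain with non-negative Ollivier curvature. Let $W\subset V$ with $m(W)\le\frac12$ and let $0<\varepsilon\le\frac18$. Then \[ |\partial W|\ge P_0\cdot\frac{\min(m(W),\varepsilon)\,\log(1/\varepsilon)}{6\operatorname{diam}_{\operatorname{obs}}^{(\varepsilon)}}. \]
   Context: $V$ finite; $P$ with symmetric support; $x\sim y$ iff $x\ne y$, $P(x,y)>0$; $d$ a finite path distance ($d(x,y)=\inf\sum d(x_{k-1},x_k)$ over paths $x=x_0\sim\dots\sim x_n=y$); $m$ the probability with $m(x)P(x,y)=m(y)P(y,x)$. $\Delta f(x)=\sum_yP(x,y)(f(y)-f(x))$; Ollivier curvature $\kappa(x,y)=\inf\{(\Delta f(x)-\Delta f(y))/d(x,y): f\ 1\text{-Lipschitz w.r.t. } d,\ f(y)-f(x)=d(x,y)\}$, assumed $\ge0$ for all $x\sim y$. $P_0=\inf_{x\sim y}P(x,y)d(x,y)^2$. $|\partial W|=\sum_{x\in W,y\notin W}P(x,y)m(x)d(x,y)$. $\operatorname{cl}(B)=B\cup\{x: x\sim y\text{ for some }y\in B\}$; $d(A,B)=\min_{a\in A,b\in B}d(a,b)$; $\operatorname{diam}_{\operatorname{obs}}^{(\varepsilon)}=\sup\{d(A,B): m(A)\ge\varepsilon,\ m(\operatorname{cl}(B))\ge\varepsilon\}$. *)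

(* Defs.v *)
From HB Require Import structures.
From mathcomp Require Import all_boot all_order all_algebra.
From mathcomp Require Import all_classical all_reals all_analysis.
Set Implicit Arguments. Unset Strict Implicit. Unset Printing Implicit Defensive.
Import Order.TTheory GRing.Theory Num.Theory.
Local Open Scope ring_scope.
Local Open Scope classical_set_scope.

Section MMC.
Variables (R : realType) (V : finType).
Variables (P : V -> V -> R) (d : V -> V -> R) (m : V -> R).

Definition markov_kernel : Prop :=
  (forall x y, 0 <= P x y) /\ (forall x, \sum_(y : V) P x y = 1).

Definition symmetric_support : Prop := forall x y, 0 < P x y <-> 0 < P y x.

Definition adj (x y : V) : bool := (x != y) && (0 < P x y).

Fixpoint plen (x : V) (p : seq V) : R :=
  if p is z :: q then d x z + plen z q else 0.

(* d is a finite path distance: d(x,y) = inf over paths x = x_0 ~ ... ~ x_n = y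
   of sum d(x_{k-1},x_k) (the set of paths being nonempty); moreover d is a
   symmetric, positive (off the diagonal) distance. *)
Definition path_distance : Prop :=
  (forall x y, d x y = d y x) /\ (forall x y, x != y -> 0 < d x y) /\
  (forall x y,
     (forall p, path adj x p -> last x p = y -> d x y <= plen x p) /\
     (forall e, 0 < e -> exists p, [/\ path adj x p, last x p = y &
                                        plen x p < d x y + e])).

Definition reversible_probability : Prop :=
  (forall x, 0 <= m x) /\ \sum_(x : V) m x = 1 /\
  (forall x y, m x * P x y = m y * P y x).

Definition measure_of (A : {set V}) : R := \sum_(x in A) m x.

Definition laplacian (f : V -> R) (x : V) : R := \sum_(y : V) P x y * (f y - f x).

Definition lipschitz1 (f : V -> R) : Prop := forall x y, `|f x - f y| <= d x y.

(* Ollivier curvature kappa(x,y) >= 0: 0 is a lower bound of the set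
   {(Delta f(x) - Delta f(y))/d(x,y) : f 1-Lipschitz, f(y)-f(x) = d(x,y)},
   i.e. its infimum is >= 0. *)
Definition curvature_lower_bound (K : R) (x y : V) : Prop :=
  forall f, lipschitz1 f -> f y - f x = d x y ->
    K <= (laplacian f x - laplacian f y) / d x y.

Definition nonneg_ollivier_curvature : Prop :=
  forall x y, adj x y -> curvature_lower_bound 0 x y.

Definition P0 : R := inf [set r : R | exists x y, adj x y /\ r = P x y * d x y ^+ 2].

Definition boundary_size (W : {set V}) : R :=
  \sum_(x in W) \sum_(y in ~: W) P x y * m x * d x y.

Definition cl (B : {set V}) : {set V} :=
  B :|: [set x | [exists y in B, adj x y]].

Definition set_dist (A B : {set V}) : R :=
  inf [set r : R | exists a b, [/\ a \in A, b \in B & r = d a b]].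

Definition diam_obs (eps : R) : R :=
  sup [set r : R | exists (A B : {set V}),
         [/\ eps <= measure_of A, eps <= measure_of (cl B) & r = set_dist A B]].

End MMC.

(* Main.v *)
Require Import Defs.
From HB Require Import structures.
From mathcomp Require Import all_boot all_order all_algebra.
From mathcomp Require Import all_classical all_reals all_analysis.
From mathcomp Require Import ring lra.
Set Implicit Arguments.
Unset Strict Implicit.
Import Order.TTheory GRing.Theory Num.Theory.
Local Open Scope ring_scope.

(** Laplacian separation: a 1-Lipschitz f whose Laplacian L f is (almost)
    constant on W and with f(x) = min over k in W of f(k) + d(k,x) is a nearly
    fixed point, up to constants, of "extend from W, then apply 1 + L/2"; this
    step is non-expansive, and non-negative curvature makes it preserve
    1-Lipschitz functions. Curvature along geodesics gives L f(x) <= L f(k) off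
    W. Put D = diam_obs, c = P0 lam and lam = log(1/eps)/(6 D). If L f exceeds c
    somewhere on W, then it is at least about c on all of W, and
    |dW| >= sum_W m (L f) finishes. Otherwise L f <= c everywhere; every x
    outside W has a neighbour z with f(z) = f(x) - d(x,z), so mass grows at
    rate at most lam along descending lines of f. By the definition of D all
    but 2 eps of the mass has f in some window [r, r + D]; testing L f <= c with
    exp(lam (r + D - f)) - 1, truncated to that window, bounds |dW| below
    by eps c. *)

(** * Path distances: triangle inequality and geodesics *)

Section PathDistance.
Variables (R : realType) (V : finType) (P d : V -> V -> R).
Hypothesis pathP : path_distance P d.

Lemma dist_sym x y : d x y = d y x.
Proof. exact: pathP.1. Qed.

Lemma dist_gt0 x y : x != y -> 0 < d x y.
Proof. exact: pathP.2.1. Qed.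

Lemma dist_le_plen x p : path (adj P) x p -> d x (last x p) <= plen d x p.
Proof. by move=> xp; apply: (pathP.2.2 x (last x p)).1. Qed.

Lemma dist_approx x y e : 0 < e ->
  exists p, [/\ path (adj P) x p, last x p = y & plen d x p < d x y + e].
Proof. by move=> e0; apply: (pathP.2.2 x y).2. Qed.

Lemma plen_ge0 x p : path (adj P) x p -> 0 <= plen d x p.
Proof.
elim: p x => [|z p IH] x //= /andP[/andP[xz _] zp].
by rewrite addr_ge0 ?IH// ltW// dist_gt0.
Qed.

Lemma dist_xx x : d x x = 0.
Proof.
apply/eqP; rewrite eq_le (@dist_le_plen x [::])//=.
apply/ler_addgt0Pr => e /(dist_approx x x)[p [xp _ /ltW]].
exact/le_trans/plen_ge0.
Qed.

Lemma dist_ge0 x y : 0 <= d x y.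
Proof.
by have [->|xy] := eqVneq x y; [rewrite dist_xx | rewrite ltW// dist_gt0].
Qed.

Lemma plen_cat x p q : plen d x (p ++ q) = plen d x p + plen d (last x p) q.
Proof. by elim: p x => [|z p IH] x /=; rewrite ?add0r// IH addrA. Qed.

Lemma dist_triangle y x z : d x z <= d x y + d y z.
Proof.
apply/ler_addgt0Pr => e e0; have e2 : 0 < e / 2 by rewrite divr_gt0.
have [p [xp py pl]] := dist_approx x y e2.
have [q [yq qz ql]] := dist_approx y z e2.
have /dist_le_plen : path (adj P) x (p ++ q) by rewrite cat_path xp py.
by rewrite last_cat py qz plen_cat py; lra.
Qed.

(** Only finitely many vertices can precede [y] on a path, so the [z] minimising [d x z + d z y]
    works for every error [e] at once. *)
Lemma geodesic_step x y : x != y ->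
  exists z, adj P z y /\ d x y = d x z + d z y.
Proof.
move=> xy.
have step e : 0 < e -> exists z, adj P z y /\ d x z + d z y < d x y + e.
  move=> /(dist_approx x y)[p]; case/lastP: p => [|p w] [+ + +].
    by move=> _ /= /eqP; rewrite (negbTE xy).
  rewrite rcons_path last_rcons -cats1 plen_cat/= addr0.
  move=> /andP[xp wy] <-; rewrite /= => pl; exists (last x p); split=> //.
  by apply: le_lt_trans pl; rewrite lerD2r dist_le_plen.
have [z0 [z0y _]] := step _ ltr01.
pose z := [arg min_(z < z0 | adj P z y) (d x z + d z y)]%O.
exists z; rewrite /z; case: arg_minP => // {}z zy zmin; split=> //.
apply/eqP; rewrite eq_le dist_triangle/=; apply/ler_addgt0Pr => e /step[t [ty tl]].
by rewrite (le_trans (zmin _ ty))// ltW.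
Qed.

End PathDistance.

(** * Non-negative curvature as a Laplacian comparison *)

Section Curvature.
Variables (R : realType) (V : finType) (P d : V -> V -> R).
Hypothesis kernelP : markov_kernel P.
Hypothesis pathP : path_distance P d.
Hypothesis curvP : nonneg_ollivier_curvature P d.

Local Notation L := (laplacian P).

Lemma laplacianE f x : L f x = \sum_y P x y * f y - f x.
Proof.
rewrite /laplacian; under eq_bigr do rewrite mulrBr.
by rewrite sumrB -mulr_suml kernelP.2 mul1r.
Qed.

Lemma kernel_sum_le x (f g : V -> R) c : (forall y, f y <= g y + c) ->
  \sum_y P x y * f y <= \sum_y P x y * g y + c.
Proof.
move=> fg; rewrite -[c in leRHS]mul1r -(kernelP.2 x) mulr_suml -big_split/=.
by apply: ler_sum => y _; rewrite -mulrDr ler_wpM2l// kernelP.1.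
Qed.

Lemma lip_le f x y : lipschitz1 d f -> f y - f x <= d x y.
Proof. by move=> /(_ y x)/ler_normlP[_]; rewrite (dist_sym pathP). Qed.

Lemma le_lip f : (forall x y, f y - f x <= d x y) -> lipschitz1 d f.
Proof.
by move=> fl x y; apply/ler_normlP; rewrite opprB fl (dist_sym pathP) fl.
Qed.

(* A gap in the Lipschitz bound on an edge is closed by raising f to
   g := max f (f y + gap - d(., y)), to which the curvature bound applies. *)
Lemma laplacian_gap_adj f x y : lipschitz1 d f -> adj P x y ->
  L f y - L f x <= 2 * (d x y - (f y - f x)).
Proof.
move=> fl xy; set gap := d x y - _.
have gap0 : 0 <= gap by rewrite subr_ge0 lip_le.
pose g z := Num.max (f z) (f y + gap - d z y).
have fg z : f z <= g z by rewrite le_max lexx.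
have gf z : g z <= f z + gap.
  rewrite ge_max; apply/andP; split; first lra.
  by have := lip_le z y fl; lra.
have gy : g y = f y + gap.
  by rewrite /g (dist_xx pathP) subr0; apply/max_idPr; lra.
have gx : g x = f x by apply/max_idPl; rewrite /gap; lra.
have gl : lipschitz1 d g.
  apply: le_lip => u v; rewrite lerBlDr ge_max; apply/andP; split.
    by have := lip_le u v fl; have := fg u; lra.
  have := dist_triangle pathP v u y.
  have : f y + gap - d u y <= g u by rewrite le_max lexx orbT.
  by lra.
have /(curvP xy gl) : g y - g x = d x y by rewrite gx gy /gap; ring.
have dxy : 0 < d x y by apply: (dist_gt0 pathP); case/andP: xy.
rewrite pmulr_lge0 ?invr_gt0// subr_ge0 !laplacianE gx gy.
(* Curvature gives [L g y <= L g x]. Passing from [f] to [g] raises [L] at [x] by at most [gap] and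
   lowers it at [y] by at most [gap], hence the factor 2. *)
have := kernel_sum_le x gf.
have /(kernel_sum_le y) : forall z, f z <= g z + 0 by move=> z; rewrite addr0.
by lra.
Qed.

(** The edge bounds telescope along an almost shortest path. *)
Lemma laplacian_gap f x y : lipschitz1 d f ->
  L f y - L f x <= 2 * (d x y - (f y - f x)).
Proof.
move=> fl; apply/ler_addgt0Pr => e e0; have e2 : 0 < e / 2 by rewrite divr_gt0.
have [p [xp py pl]] := dist_approx pathP x y e2.
suff : L f y - L f x <= 2 * (plen d x p - (f y - f x)) by lra.
rewrite -{}py {pl}; elim: p x xp => [|z p IH] x /=; first by rewrite !subrr; lra.
by move=> /andP[/(laplacian_gap_adj fl) + /IH]; lra.
Qed.

End Curvature.

Section Geometric.
Import numFieldNormedType.Exports.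

Lemma expr_small (R : realType) (a e : R) : 0 <= a < 1 -> 0 < e ->
  exists n, a ^+ n < e.
Proof.
move=> /andP[a0 a1] e0.
have /cvgr0_norm_lt/(_ e e0)[N _ /(_ N (leqnn N))] :
    (GRing.exp a n @[n --> \oo] --> (0 : R))%classic.
  by apply: cvg_expr; rewrite ger0_norm.
by rewrite /= ger0_norm ?exprn_ge0//; exists N.
Qed.

End Geometric.

(** * Laplacian separation by a vanishing discount *)

Section Separation.
Variables (R : realType) (V : finType) (P d : V -> V -> R).
Hypothesis kernelP : markov_kernel P.
Hypothesis pathP : path_distance P d.
Hypothesis curvP : nonneg_ollivier_curvature P d.
Variables (W : {set V}) (k0 : V).
Hypothesis k0W : k0 \in W.

Local Notation L := (laplacian P).

(** The McShane extension: the largest 1-Lipschitz function below [g] on [W]. The point [k0] is only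
    the starting value of the arg min. *)
Definition lip_extension (g : V -> R) (x : V) : R :=
  let k := [arg min_(k < k0 in W) (g k + d k x)]%O in g k + d k x.

Local Notation S := lip_extension.

Lemma lip_extension_attained g x : exists2 k, k \in W & S g x = g k + d k x.
Proof. by rewrite /S; case: arg_minP => // k kW _; exists k. Qed.

Lemma lip_extension_le g x k : k \in W -> S g x <= g k + d k x.
Proof. by rewrite /S; case: arg_minP => // i _ le_i /le_i. Qed.

Lemma lip_extension_lip g : lipschitz1 d (S g).
Proof.
apply: (le_lip pathP) => x y; have [k kW ->] := lip_extension_attained g x.
have := lip_extension_le g y kW; have := dist_triangle pathP x k y; lra.
Qed.

Lemma lip_extension_id g k : lipschitz1 d g -> k \in W -> S g k = g k.
Proof.
move=> gl kW; apply/eqP; rewrite eq_le; apply/andP; split.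
  by have := lip_extension_le g k kW; rewrite (dist_xx pathP) addr0.
have [j jW ->] := lip_extension_attained g k.
by have := lip_le pathP j k gl; lra.
Qed.

(** The weight 1/2 cancels the factor 2 of [laplacian_gap], so that 1-Lipschitz functions are
    preserved. *)
Definition lazy_step (h : V -> R) (x : V) : R := h x + L h x / 2.

Local Notation Q := lazy_step.

Lemma lazy_step_lip h : lipschitz1 d h -> lipschitz1 d (Q h).
Proof.
move=> hl; apply: (le_lip pathP) => x y; rewrite /Q.
by have := laplacian_gap kernelP pathP curvP x y hl; lra.
Qed.

Lemma lazy_step_le h h' c : (forall x, h x <= h' x + c) ->
  forall x, Q h x <= Q h' x + c.
Proof.
move=> hh x; rewrite /Q !(laplacianE kernelP).
by have := kernel_sum_le kernelP x hh; have := hh x; lra.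
Qed.

Section Iteration.
Variable a : R.
Hypothesis a01 : 0 <= a <= 1.

(** The factor [a] turns a non-expansive map into an [a]-contraction in supremum norm, so iterates
    settle geometrically when [a < 1]. *)
Definition discounted_step (f : V -> R) : V -> R := Q (S (fun x => a * f x)).

Local Notation T := discounted_step.
Local Notation fn := (fun n => iter n T (fun=> 0)).

Lemma lip_scale f : lipschitz1 d f -> lipschitz1 d (fun x => a * f x).
Proof.
move=> fl x y; case/andP: a01 => a0 a1.
rewrite -mulrBr normrM (ger0_norm a0); apply: le_trans (fl x y).
by rewrite -[leRHS]mul1r ler_wpM2r.
Qed.

Lemma discounted_step_le f g c : (forall x, f x <= g x + c) ->
  forall x, T f x <= T g x + a * c.
Proof.
move=> fg; apply: lazy_step_le => x; case/andP: a01 => a0 a1.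
have [k kW ->] := lip_extension_attained (fun x => a * g x) x.
apply: le_trans (lip_extension_le _ _ kW) _.
by have := ler_wpM2l a0 (fg k); lra.
Qed.

Lemma iterate_lip n : lipschitz1 d (fn n).
Proof.
case: n => [|n] /=; first by move=> x y; rewrite subrr normr0 (dist_ge0 pathP).
exact/lazy_step_lip/lip_extension_lip.
Qed.

Lemma iterate_close : exists2 M, 0 <= M & forall n x,
  `|fn n.+1 x - fn n x| <= a ^+ n * M.
Proof.
exists (\sum_x `|fn 1 x|) => [|n]; first exact: sumr_ge0.
set M := \sum_x _.
suff H : (forall x, fn n.+1 x <= fn n x + a ^+ n * M) /\
         (forall x, fn n x <= fn n.+1 x + a ^+ n * M).
  move=> x; apply/ler_normlP; rewrite opprB; move: H => [/(_ x) + /(_ x)]; split; lra.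
elim: n => [|n [IH1 IH2]].
  have M1 x : `|fn 1 x| <= M by rewrite /M (bigD1 x)//= lerDl sumr_ge0.
  split=> x; rewrite expr0 mul1r; have /ler_normlP[] := M1 x => /=; lra.
by split=> x; rewrite exprS -mulrA; apply: discounted_step_le.
Qed.

End Iteration.

(* A fixed point g of [discounted_step a] has L (S (a g)) = 2 (1 - a) g on W,
   which oscillates by at most 2 (1 - a) times the diameter; a large iterate is
   close enough to such a g. *)
Lemma laplacian_separation e : 0 < e -> exists f, [/\ lipschitz1 d f,
  forall x, exists2 k, k \in W & f x = f k + d k x &
  forall k k', k \in W -> k' \in W -> L f k <= L f k' + e].
Proof.
move=> e0; pose D := \sum_x \sum_y d x y.
have dD x y : d x y <= D.
  rewrite /D (bigD1 x)//= (bigD1 y)//= -addrA lerDl addr_ge0//.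
    by apply: sumr_ge0 => z _; exact: (dist_ge0 pathP).
  by apply: sumr_ge0 => z _; apply: sumr_ge0 => t _; exact: (dist_ge0 pathP).
have D0 : 0 <= D by apply: le_trans (dD k0 k0); exact: (dist_ge0 pathP).
have De : 0 < 4 * (D + e) by lra.
(* The final error is twice the sum of [b * D <= e / 4], from the discount, and two iteration errors
   [e / 8]. *)
pose b := e / (4 * (D + e)).
have b0 : 0 < b by rewrite divr_gt0.
have b1 : b < 1 by rewrite ltr_pdivrMr// mul1r; lra.
have bD : b * D <= e / 4.
  rewrite /b mulrAC ler_pdivrMr//.
  have : 0 <= e * e by rewrite mulr_ge0 ?ltW.
  by lra.
have a01 : 0 <= 1 - b <= 1 by lra.
have a01' : 0 <= 1 - b < 1 by lra.
have [M M0 close] := iterate_close a01.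
have M1 : 0 < 8 * (M + 1) by lra.
have [n an] := expr_small a01' (divr_gt0 e0 M1).
have anM : (1 - b) ^+ n * M <= e / 8.
  have : (1 - b) ^+ n * (8 * (M + 1)) <= e by rewrite -ler_pdivlMr// ltW.
  have : 0 <= (1 - b) ^+ n by rewrite exprn_ge0//; lra.
  lra.
set fn := fun n => iter n (discounted_step (1 - b)) (fun=> 0).
have fl : lipschitz1 d (fun x => (1 - b) * fn n x).
  exact/lip_scale/iterate_lip.
pose f := S (fun x => (1 - b) * fn n x).
have fW k : k \in W -> f k = (1 - b) * fn n k.
  by move=> kW; exact: lip_extension_id.
have Lf k : k \in W -> L f k = 2 * (fn n.+1 k - (1 - b) * fn n k).
  move=> kW; rewrite [fn n.+1 k]/(Q f k) /Q -fW//; lra.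
exists f; split=> [|x|k k' kW k'W]; first exact: lip_extension_lip.
  have [k kW fx] := lip_extension_attained (fun x => (1 - b) * fn n x) x.
  by exists k => //; rewrite (fW _ kW).
rewrite !Lf//.
have /ler_normlP[_ c1] := close n k.
have /ler_normlP[c2 _] := close n k'.
rewrite -/(fn n) -/(fn n.+1) in c1 c2.
have : b * (fn n k - fn n k') <= b * D.
  apply: ler_wpM2l; [exact: ltW | apply: le_trans (dD k' k)].
  by apply: (lip_le pathP); exact: iterate_lip.
by lra.
Qed.

End Separation.

(** * Green's formula and boundary flux *)

Section Flux.
Variables (R : realType) (V : finType) (P d : V -> V -> R) (m : V -> R).
Hypothesis kernelP : markov_kernel P.
Hypothesis suppP : symmetric_support P.
Hypothesis pathP : path_distance P d.
Hypothesis revP : reversible_probability P m.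

Local Notation L := (laplacian P).
Local Notation w x y := (m x * P x y).
Local Notation drop f x y := (Num.max 0 (f x - f y)).

Lemma weight_ge0 x y : 0 <= w x y.
Proof. by rewrite mulr_ge0 ?revP.1 ?kernelP.1. Qed.

Lemma measure_le (A B : {set V}) : A \subset B ->
  measure_of m A <= measure_of m B.
Proof.
move=> AB; rewrite /measure_of [leRHS](big_setID A)/= (finset.setIidPr AB) lerDl.
by apply: sumr_ge0 => x _; exact: revP.1.
Qed.

Lemma measure_setC (A : {set V}) : measure_of m (~: A) = 1 - measure_of m A.
Proof.
rewrite -revP.2.1 /measure_of [X in _ = X - _](bigID (mem A))/= addrAC subrr add0r.
by apply: eq_bigl => x; rewrite inE.
Qed.

(** Reversibility turns each boundary edge around, to point into [W] as in [green]. *)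
Lemma boundary_sizeE (W : {set V}) : boundary_size P d m W =
  \sum_x \sum_y (if (x \notin W) && (y \in W) then w x y * d x y else 0).
Proof.
rewrite /boundary_size big_mkcond [RHS]exchange_big/=; apply: eq_bigr => x _.
case: (x \in W); last by rewrite big1// => y _; rewrite andbF.
rewrite big_mkcond/=; apply: eq_bigr => y _; rewrite inE andbT; case: ifP => // _.
by rewrite (mulrC (P x y)) revP.2.2 (dist_sym pathP).
Qed.

Lemma boundary_size_ge0 (W : {set V}) : 0 <= boundary_size P d m W.
Proof.
rewrite boundary_sizeE; apply: sumr_ge0 => x _; apply: sumr_ge0 => y _.
by case: ifP => // _; rewrite mulr_ge0 ?weight_ge0 ?(dist_ge0 pathP).
Qed.

Lemma P0_ge0 : 0 <= P0 P d.
Proof.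
rewrite /P0; set E := mkset _.
have [[r Er]|E0] := pselect (exists r, E r).
  apply: lb_le_inf; first by exists r.
  by move=> _ [x [y [_ ->]]]; rewrite mulr_ge0 ?kernelP.1 ?sqr_ge0.
(* Without edges, [P0] is the infimum of the empty set, which is 0. *)
suff -> : E = set0%classic by rewrite inf0.
by apply/seteqP; split=> // r Er; case: E0; exists r.
Qed.

Lemma P0_le x y : adj P x y -> P0 P d <= P x y * d x y ^+ 2.
Proof.
move=> xy; apply: ge_inf; last by exists x, y.
by exists 0 => _ [z [t [_ ->]]]; rewrite mulr_ge0 ?kernelP.1 ?sqr_ge0.
Qed.

Lemma drop_sub (f : V -> R) x y : drop f y x - drop f x y = f y - f x.
Proof. by rewrite -(opprB (f y)) !maxEle; do 2!case: ifP; lra. Qed.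

Lemma drop_le (f : V -> R) x y : lipschitz1 d f -> drop f x y <= d x y.
Proof.
move=> fl; rewrite ge_max (dist_ge0 pathP)/= (dist_sym pathP).
exact: (lip_le pathP).
Qed.

Lemma drop_ge0 (f : V -> R) x y : 0 <= drop f x y.
Proof. by rewrite le_max lexx. Qed.

(** Splitting [f y - f x] into two positive parts and exchanging the sums counts each edge only in
    the direction in which [f] descends. *)
Lemma green (f phi : V -> R) : \sum_x m x * phi x * L f x =
  \sum_x \sum_y w x y * drop f x y * (phi y - phi x).
Proof.
transitivity (\sum_x \sum_y w x y * drop f y x * phi x -
              \sum_x \sum_y w x y * drop f x y * phi x).
  rewrite -sumrB; apply: eq_bigr => x _; rewrite -sumrB mulr_sumr.
  by apply: eq_bigr => y _; rewrite -mulrBl -mulrBr drop_sub; ring.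
rewrite exchange_big/= -sumrB; apply: eq_bigr => x _; rewrite -sumrB.
by apply: eq_bigr => y _; rewrite [w y x]revP.2.2 mulrBr.
Qed.

(** In [green] with the indicator of [W], only edges entering [W] count positively, each with a drop
    of at most [d x y]. *)
Lemma laplacian_flux f (W : {set V}) : lipschitz1 d f ->
  \sum_(x in W) m x * L f x <= boundary_size P d m W.
Proof.
move=> fl; have := green f (fun x => (x \in W)%:R).
under eq_bigr do rewrite -mulrA (mulrC _%:R) mulr_natr mulrb.
under eq_bigr do rewrite (fun_if ( *%R (m _))) mulr0.
rewrite -big_mkcond/= => ->; rewrite boundary_sizeE.
apply: ler_sum => x _; apply: ler_sum => y _.
have := ler_wpM2l (weight_ge0 x y) (drop_le x y fl).
have := mulr_ge0 (weight_ge0 x y) (drop_ge0 f x y).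
by case: (x \in W); case: (y \in W) => /=; lra.
Qed.

(* Green's formula for h o f cut off to 0 on W: every edge leaving the
   complement of W costs at most H in the cut-off. *)
Lemma level_flux (f : V -> R) (h : R -> R) (H : R) (W : {set V}) :
  lipschitz1 d f -> (forall s, 0 <= h s <= H) ->
  \sum_(x in ~: W) \sum_y w x y * drop f x y * (h (f y) - h (f x)) <=
  \sum_(x in ~: W) m x * h (f x) * L f x + H * boundary_size P d m W.
Proof.
move=> fl hH; pose phi x := if x \in W then 0 else h (f x).
have -> : \sum_(x in ~: W) m x * h (f x) * L f x =
          \sum_x m x * phi x * L f x.
  rewrite big_mkcond; apply: eq_bigr => x _.
  by rewrite inE /phi; case: (x \in W) => //=; rewrite mulr0 mul0r.
rewrite green boundary_sizeE mulr_sumr -big_split big_mkcond/=.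
apply: ler_sum => x _; rewrite mulr_sumr -big_split inE.
have -> (F : V -> R) : (if x \notin W then \sum_y F y else 0) =
    \sum_y if x \notin W then F y else 0.
  by case: ifP => // _; rewrite big1.
apply: ler_sum => y _ /=.
have [hx0 hxH] := andP (hH (f x)); have [hy0 hyH] := andP (hH (f y)).
have u0 := mulr_ge0 (weight_ge0 x y) (drop_ge0 f x y).
have ud := ler_wpM2l (weight_ge0 x y) (drop_le x y fl).
have := mulr_ge0 u0 hx0; have := mulr_ge0 u0 hy0.
have := ler_wpM2l u0 hyH; have := ler_wpM2r (le_trans hx0 hxH) ud.
by rewrite /phi; case: (x \in W); case: (y \in W) => /=; lra.
Qed.

(** * Mass growth along descending lines *)

Section Growth.
Variables (f : V -> R) (W : {set V}) (lam r D eps : R).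
Hypothesis fl : lipschitz1 d f.
Hypothesis fW : forall x, exists2 k, k \in W & f x = f k + d k x.
Hypotheses (lam0 : 0 < lam) (D0 : 0 < D).

(** Depth below the top of the window [[r, r + D]], clipped to [[0, D]]; thus [h] is 0 above the
    window and [q - 1] below it. *)
Let T s := Num.max 0 (Num.min D (r + D - s)).
Let h s := expR (lam * T s) - 1.
Let q := expR (lam * D).

Let h_bounds s : 0 <= h s <= q - 1.
Proof.
have T0 : 0 <= T s by rewrite le_max lexx.
have TD : T s <= D by rewrite ge_max (ltW D0) ge_min lexx.
rewrite /h subr_ge0 lerD2r ler_expR ler_pM2l// TD andbT.
by rewrite -expR0 ler_expR mulr_ge0// ltW.
Qed.

Let h_noninc (s t : R) : s <= t -> h t <= h s.
Proof.
move=> st; rewrite lerD2r ler_expR ler_pM2l// ge_max !le_max lexx/= orbC.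
by rewrite le_min !ge_min lexx/= -lerBlDr opprK; apply/orP; left; apply/orP; right; lra.
Qed.

Let h_high (s : R) : r + D <= s -> h s = 0.
Proof.
have Dp := D0; move=> s_hi; rewrite /h /T min_r; last lra.
by rewrite max_l ?mulr0 ?expR0 ?subrr//; lra.
Qed.

Let h_slope (s t : R) : r <= s - t -> 0 <= t -> s <= r + D ->
  lam * t * (h s + 1) <= h (s - t) - h s.
Proof.
move=> st t0 s_hi; rewrite /h /T !min_r ?max_r; [|lra..].
have -> : lam * (r + D - (s - t)) = lam * (r + D - s) + lam * t by ring.
rewrite expRD; have := expR_gt0 (lam * (r + D - s)).
move: (expR_ge1Dx (lam * t)) => e1 e0.
have := ler_wpM2l (ltW e0) e1; lra.
Qed.

(** On a geodesic from the point [k] realising [f x], the Lipschitz bounds are equalities; [z] is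
    its last vertex before [x]. *)
Lemma descending_step x : x \notin W ->
  exists z, adj P x z /\ f z = f x - d x z.
Proof.
move=> xW; have [k kW fx] := fW x.
have kx : k != x by apply: contraNneq xW => <-.
have [z [/andP[zx Pzx] dkx]] := geodesic_step pathP kx.
exists z; split; first by rewrite /adj eq_sym zx; apply/suppP.
have := lip_le pathP k z fl; have := lip_le pathP z x fl.
by rewrite (dist_sym pathP x z); lra.
Qed.

(** In the window, the exponential slope of [h] yields at least [c * m x * (h (f x) + 1)], while
    [L f <= c] charges only [c * m x * h (f x)]. The surplus [c * m x] is paid for by the
    boundary. *)
Lemma mass_growth :
  (forall x, x \notin W -> L f x <= P0 P d * lam) ->
  measure_of m W <= 1 / 2 ->
  measure_of m (cl P [set x | f x < r]) <= eps ->
  measure_of m [set x | r + D < f x] <= eps ->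
  P0 P d * lam * (1 / 2 - q * eps - eps) <= (q - 1) * boundary_size P d m W.
Proof.
move=> Lf mW mlo mhi; set lo := cl _ _ in mlo; set hi := finset _ in mhi.
set c := P0 P d * lam; have c0 : 0 <= c by rewrite mulr_ge0 ?P0_ge0 ?ltW.
have q0 : 0 < q := expR_gt0 _.
(* Outside the window the left side must be nonpositive: on [lo] the loss [q * m x] absorbs
   [h <= q - 1], and on [hi] the loss [m x] suffices since [h] vanishes. *)
have local x : x \notin W ->
    c * (m x - q * (if x \in lo then m x else 0) - (if x \in hi then m x else 0))
      + m x * h (f x) * c <=
    \sum_y w x y * drop f x y * (h (f y) - h (f x)).
  move=> xW; have mx := revP.1 x.
  have [hx0 hxH] := andP (h_bounds (f x)).
  have u0 y : 0 <= w x y * drop f x y * (h (f y) - h (f x)).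
    rewrite maxEle; case: ifP => [|_]; last by rewrite mulr0 mul0r.
    rewrite subr_ge0 => fyx.
    by rewrite !mulr_ge0 ?revP.1 ?kernelP.1 ?subr_ge0 ?h_noninc.
  have cm : 0 <= c * m x by rewrite mulr_ge0.
  have cmh := mulr_ge0 cm hx0.
  have [xlo|xlo] := boolP (x \in lo).
    apply: le_trans (sumr_ge0 _ (fun y _ => u0 y)).
    have := ler_wpM2l cm hxH; case: ifP => _; lra.
  have [xhi|] := boolP (x \in hi).
    apply: le_trans (sumr_ge0 _ (fun y _ => u0 y)).
    by rewrite h_high; [lra | move: xhi; rewrite inE => /ltW].
  rewrite inE -leNgt => xhi.
  have [z [xz fz]] := descending_step xW.
  (* This is where the closure [cl] enters: a neighbour below level [r] would put [x] in [lo]. *)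
  have rfz : r <= f z.
    rewrite leNgt; apply: contra xlo => zr; rewrite !inE; apply/orP; right.
    by apply/existsP; exists z; rewrite inE zr.
  rewrite (bigD1 z)//=; apply: ler_wpDr; first by apply: sumr_ge0 => y _.
  have dxz := dist_ge0 pathP x z.
  have -> : drop f x z = d x z by rewrite fz max_r; lra.
  rewrite fz in rfz *; have := h_slope rfz dxz xhi.
  move=> /(ler_wpM2l (mulr_ge0 (weight_ge0 x z) dxz)); apply: le_trans.
  have h1 : 0 <= h (f x) + 1 by lra.
  (* One factor [d x z] comes from the drop of [f], the other from the slope of [h]; together they
     form the square in [P0]. *)
  have := ler_wpM2l (mulr_ge0 (mulr_ge0 mx (ltW lam0)) h1) (P0_le xz).
  by rewrite /c; lra.
have := level_flux W fl h_bounds.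
have : \sum_(x in ~: W) m x * h (f x) * L f x <= \sum_(x in ~: W) m x * h (f x) * c.
  apply: ler_sum => x; rewrite inE => /Lf.
  by apply: ler_wpM2l; rewrite mulr_ge0 ?revP.1//; case/andP: (h_bounds (f x)).
have : \sum_(x in ~: W) (c * (m x - q * (if x \in lo then m x else 0)
      - (if x \in hi then m x else 0)) + m x * h (f x) * c) <=
    \sum_(x in ~: W) \sum_y w x y * drop f x y * (h (f y) - h (f x)).
  by apply: ler_sum => x; rewrite inE; exact: local.
rewrite big_split/= -mulr_sumr !sumrB -mulr_sumr.
have restrict_le (A : {set V}) :
    \sum_(x in ~: W) (if x \in A then m x else 0) <= measure_of m A.
  rewrite /measure_of [leRHS]big_mkcond [leLHS]big_mkcond/=; apply: ler_sum => x _.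
  by have := revP.1 x; case: ifP; case: ifP.
have := restrict_le hi; have := restrict_le lo.
set slo := \sum_(x in ~: W) _; set shi := \sum_(x in ~: W) _ => lo_le hi_le.
have : measure_of m (~: W) = 1 - measure_of m W := measure_setC W.
rewrite /measure_of -/(measure_of m W) => -> G1 G2 G3.
suff : c * (1 / 2 - q * eps - eps) <= c * (1 - measure_of m W - q * slo - shi) by lra.
apply: ler_wpM2l => //.
have := ler_wpM2l (ltW q0) (le_trans lo_le mlo); lra.
Qed.

End Growth.

End Flux.

(** * Critical levels and the observable diameter *)

(** Take the lowest level reaching [c]: its strict sublevel set is empty or is the sublevel set of a
    lower value, so it stays below [c]. *)
Lemma critical_level (R : realType) (V : finType) (f : V -> R)
    (G : {set V} -> R) (c : R) :
  c <= G [set: V] -> G finset.set0 < c ->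
  exists v, c <= G [set x | f x <= f v] /\ G [set x | f x < f v] < c.
Proof.
move=> cT c0.
have max_level (A : {set V}) : A != finset.set0 ->
    exists2 v, v \in A & forall x, x \in A -> f x <= f v.
  case/set0Pn => a aA; exists [arg max_(v > a in A) f v]%O;
  by case: arg_maxP => // v vA vmax x /vmax.
have VT : [set: V] != finset.set0 by apply/eqP => VT; move: cT; rewrite VT leNgt c0.
have [t _ tmax] := max_level _ VT.
have ct : c <= G [set x | f x <= f t].
  by suff -> : [set x | f x <= f t] = [set: V] by []; apply/setP=> x; rewrite !inE tmax.
pose v := [arg min_(v < t | c <= G [set x | (f x <= f v)%R]) f v]%O.
exists v; rewrite /v; case: arg_minP => // {}v cv vmin; split=> //.
rewrite ltNge; apply/negP => cv'.
have lt0 : [set x | f x < f v] != finset.set0.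
  by apply/eqP => E; move: cv'; rewrite E leNgt c0.
have [u] := max_level _ lt0; rewrite inE => uv umax.
have /vmin : c <= G [set x | f x <= f u].
  suff -> : [set x | f x <= f u] = [set x | f x < f v] by [].
  apply/setP => x; rewrite !inE; apply/idP/idP => [/le_lt_trans-> //|xv].
  by apply: umax; rewrite inE.
by rewrite leNgt uv.
Qed.

Section ObservableDiameter.
Variables (R : realType) (V : finType) (P d : V -> V -> R) (m : V -> R).
Hypothesis pathP : path_distance P d.
Hypothesis revP : reversible_probability P m.

(** The supremum needs an upper bound: [0 < eps] makes both sets nonempty, so the sum of all
    distances serves. *)
Lemma set_dist_le_diam_obs eps (A B : {set V}) : 0 < eps ->
  eps <= measure_of m A -> eps <= measure_of m (cl P B) ->
  set_dist d A B <= diam_obs P d m eps.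
Proof.
move=> e0 mA mB; apply: ub_le_sup; last by exists A, B.
exists (\sum_x \sum_y d x y) => _ [{mA mB}A [{}B [mA mB ->]]].
have /set0Pn[a aA] : A != finset.set0.
  by apply/eqP => A0; move: mA; rewrite A0 /measure_of big_set0 leNgt e0.
have /set0Pn[b bB] : B != finset.set0.
  apply/eqP => B0; move: mB; rewrite B0 /cl finset.set0U /measure_of big1 ?leNgt ?e0//.
  by move=> x; rewrite inE => /existsP[y]; rewrite inE.
apply: (@le_trans _ _ (d a b)).
  apply: ge_inf; last by exists a, b.
  by exists 0 => _ [x [y [_ _ ->]]]; exact: (dist_ge0 pathP).
rewrite (bigD1 a)//= (bigD1 b)//= -addrA lerDl addr_ge0//.
  by apply: sumr_ge0 => z _; exact: (dist_ge0 pathP).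
by apply: sumr_ge0 => z _; apply: sumr_ge0 => t _; exact: (dist_ge0 pathP).
Qed.

(** With [v] critical from below (mass of closures) and [u] from above, [{f <= f v}] and
    [{f >= f u}] compete in [diam_obs], so [f u - f v] is at most the diameter; [r] is [f v]. *)
Lemma lip_concentration f eps : 0 < eps <= 1 -> lipschitz1 d f ->
  exists r, measure_of m (cl P [set x | f x < r]) <= eps /\
            measure_of m [set x | r + diam_obs P d m eps < f x] <= eps.
Proof.
move=> /andP[e0 e1] fl.
have mT : measure_of m [set: V] = 1.
  by rewrite -revP.2.1; apply: eq_bigl => x; rewrite inE.
have m0 : measure_of m finset.set0 = 0 by rewrite /measure_of big_set0.
have clT : cl P [set: V] = [set: V] by rewrite /cl finset.setTU.
have cl0 : cl P finset.set0 = finset.set0.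
  apply/setP => x; rewrite !inE; apply/existsP => -[y]; by rewrite inE.
have [||v [v1 v2]] := critical_level f (G := fun A => measure_of m (cl P A)) (c := eps).
- by rewrite clT mT.
- by rewrite cl0 m0.
have [||u [u1 u2]] := critical_level (fun x => - f x) (G := measure_of m) (c := eps).
- by rewrite mT.
- by rewrite m0.
exists (f v); split; first exact: ltW.
apply: le_trans (ltW u2); apply: (measure_le revP); apply/fintype.subsetP => x; rewrite !inE ltrN2.
apply: le_lt_trans; rewrite -lerBlDl.
apply: le_trans (set_dist_le_diam_obs e0 u1 v1); apply: lb_le_inf.
  by exists (d u v), u, v; rewrite !inE !lexx.
move=> _ [a [b [+ + ->]]]; rewrite !inE lerN2 => ua bv.
by have := lip_le pathP b a fl; rewrite (dist_sym pathP b a); lra.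
Qed.

End ObservableDiameter.

(* With q = eps^(-1/6) the growth estimate needs eps q <= 1/4, i.e.
   eps^5 <= 4^(-6), which holds with room to spare at eps = 1/8. *)
Lemma expR_sixth_ln_bound (R : realType) (eps : R) : 0 < eps -> eps <= 1 / 8 ->
  expR (ln (1 / eps) / 6) * eps <= 1 / 4.
Proof.
move=> e0 e8; set q := expR _.
have q0 : 0 < q := expR_gt0 _.
have q6 : q ^+ 6 * eps = 1.
  rewrite -expRM_natl -mulr_natl mulrCA divff// mulr1 lnK ?mul1r ?mulVf ?gt_eqF//.
  by rewrite posrE invr_gt0.
have qe0 : 0 <= q * eps by rewrite mulr_ge0 ?ltW.
rewrite -(@ler_pXn2r _ 6) ?nnegrE ?divr_ge0//.
have -> : (q * eps) ^+ 6 = eps ^+ 5 by rewrite exprMn (exprS eps 5) mulrA q6 mul1r.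
have : eps ^+ 5 <= (1 / 8) ^+ 5.
  by rewrite ler_pXn2r// nnegrE; lra.
by move/le_trans; apply; rewrite !expr_div_n !expr1n; lra.
Qed.

(** * The isoperimetric inequality *)

Theorem theorem6p1 (R : realType) (V : finType)
    (P : V -> V -> R) (d : V -> V -> R) (m : V -> R)
    (W : {set V}) (eps : R) :
  markov_kernel P ->
  symmetric_support P ->
  path_distance P d ->
  reversible_probability P m ->
  nonneg_ollivier_curvature P d ->
  measure_of m W <= 1 / 2 ->
  0 < eps -> eps <= 1 / 8 ->
  boundary_size P d m W >=
    P0 P d * (Num.min (measure_of m W) eps * ln (1 / eps))
      / (6 * diam_obs P d m eps).
Proof.
move=> kernelP suppP pathP revP curvP mW e0 e8.
set D := diam_obs _ _ _ _; set a := boundary_size _ _ _ _.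
set mu := Num.min _ _; set p := P0 P d.
have a0 : 0 <= a := boundary_size_ge0 kernelP pathP revP W.
have p0 : 0 <= p := P0_ge0 d kernelP.
have mW0 : 0 <= measure_of m W by apply: sumr_ge0 => x _; exact: revP.1.
have mu0 : 0 <= mu by rewrite le_min mW0 ltW.
have ln0 : 0 < ln (1 / eps) by rewrite ln_gt0// div1r invf_gt1//; lra.
(* For [D <= 0] the claimed bound is nonpositive, including [D = 0], where the inverse is 0 by
   convention. *)
have [Dneg|D0] := leP D 0.
  apply: le_trans a0; apply: mulr_ge0_le0.
    by rewrite !mulr_ge0// ltW.
  by rewrite invr_le0 pmulr_rle0.
pose lam := ln (1 / eps) / (6 * D).
have lam0 : 0 < lam by rewrite divr_gt0// mulr_gt0.
have -> : p * (mu * ln (1 / eps)) / (6 * D) = p * lam * mu.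
  by rewrite /lam; field; rewrite gt_eqF.
have [W0|/set0Pn[k0 k0W]] := eqVneq W finset.set0.
  have -> : mu = 0.
    by rewrite /mu W0 /measure_of big_set0 min_l// ltW.
  by rewrite mulr0.
apply/ler_addgt0Pr => e epos.
have [f [fl fW Lf]] := laplacian_separation kernelP pathP curvP k0W epos.
have muW : mu <= measure_of m W by rewrite ge_min lexx.
have mue : mu <= eps by rewrite ge_min lexx orbT.
have c0 : 0 <= p * lam by rewrite mulr_ge0// ltW.
have [/forall_inP small|] :=
  boolP [forall (k | k \in W), laplacian P f k <= p * lam].
  (* The Lipschitz gap between [k] and [x] is zero, so [laplacian_gap] transports the bound from
     [W]. *)
  have Lc x : x \notin W -> laplacian P f x <= p * lam.
    move=> _; have [k kW fx] := fW x; apply: le_trans (small k kW).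
    have := laplacian_gap kernelP pathP curvP k x fl.
    by rewrite fx; lra.
  have e1 : 0 < eps <= 1 by lra.
  have [r [rlo rhi]] := lip_concentration pathP revP e1 fl.
  have := mass_growth kernelP suppP pathP revP fl fW lam0 D0 Lc mW rlo rhi.
  rewrite -/a -/p; have -> : lam * D = ln (1 / eps) / 6.
    by rewrite /lam; field; rewrite gt_eqF.
  have := expR_sixth_ln_bound e0 e8.
  have : 1 < expR (ln (1 / eps) / 6) by rewrite expR_gt1 divr_gt0.
  move: (expR _) => q q1 qe; set s := p * lam in c0 * => G.
  have q10 : 0 < q - 1 by lra.
  suff : s * mu <= a by lra.
  apply: (@le_trans _ _ (s * eps)); first exact: ler_wpM2l.
  rewrite -(ler_pM2l q10); apply: le_trans G.
  (* It remains to see [q * eps - eps <= 1 / 2 - q * eps - eps], which is exactly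
     [q * eps <= 1 / 4]. *)
  have -> : (q - 1) * (s * eps) = s * (q * eps - eps) by ring.
  apply: ler_wpM2l => //; lra.
rewrite negb_forall_in => /exists_inP[k kW]; rewrite -ltNge => Lk.
have : \sum_(x in W) m x * (p * lam - e) <= a.
  apply: le_trans (laplacian_flux kernelP pathP revP W fl).
  apply: ler_sum => x xW; apply: ler_wpM2l; first exact: revP.1.
  by have := Lf k x kW xW; lra.
rewrite -mulr_suml -/(measure_of m W) => G.
have := ler_wpM2l c0 muW.
have mW1 : measure_of m W <= 1 by lra.
have := ler_wpM2r (ltW epos) mW1; lra.
Qed.
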